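(* Let $G$ be a connected graph of order $n \geq 2$. For any vertex $x$ of $G$ with eccentricity $\mathrm{e}(x)$ we have $p_x(G) \geq \frac{n-1}{\mathrm{e}(x)}$. Thus $\mathrm{vp}^-(G) \geq \frac{n-1}{\mathrm{diam}(G)}$ and $\mathrm{vp}(G) \geq \frac{n-1}{\mathrm{rad}(G)}$.
   Context: All graphs are finite, undirected and simple. A $u,v$-geodesic is a shortest $u,v$-path. The eccentricity of $x$ is $\mathrm{e}(x) = \max_{v \in V(G)} d(x,v)$; $\mathrm{diam}(G)$ and $\mathrm{rad}(G)$ are the maximum and minimum eccentricity over all vertices. For a vertex $x$ of $G$, a set $S \subseteq V(G)$ is an $x$-position set if for every $y \in S$ no vertex of $S \setminus \{y\}$ lies on any $x,y$-geodesic in $G$. The $x$-position number $p_x(G)$ is the maximum cardinality of an $x$-position set of $G$. Define $\mathrm{vp}(G) = \max_{x \in V(G)} p_x(G)$ and $\mathrm{vp}^-(G) = \min_{x \in V(G)} p_x(G)$. *)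

(* Defs.v *)
From mathcomp Require Import all_boot.

Set Implicit Arguments.
Unset Strict Implicit.
Unset Printing Implicit Defensive.

(* A finite graph is given by its adjacency relation [adj] on the finType [T]
   of its vertices; it is undirected and simple when [adj] is symmetric and
   irreflexive. *)

Definition connected_graph (T : finType) (adj : rel T) : Prop :=
  forall u v : T, connect adj u v.

(* The path has vertex sequence u :: p, hence size p is its number of edges. *)
Definition uv_path (T : finType) (adj : rel T) (u v : T) (p : seq T) : bool :=
  [&& path adj u p, last u p == v & uniq (u :: p)].

Definition has_uv_path (T : finType) (adj : rel T) (u v : T) (k : nat) : bool :=
  [exists p : k.-tuple T, uv_path adj u v p].

(* The least length of a u,v-path; a path has fewer than #|T| edges, and the
   value is #|T| when no u,v-path exists. *)
Definition dist (T : finType) (adj : rel T) (u v : T) : nat :=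
  find (has_uv_path adj u v) (iota 0 #|T|).

Definition geodesic (T : finType) (adj : rel T) (u v : T) (p : seq T) : bool :=
  uv_path adj u v p && (size p == dist adj u v).

Definition on_geodesic (T : finType) (adj : rel T) (u v z : T) : Prop :=
  exists p : seq T, geodesic adj u v p /\ z \in u :: p.

Definition on_geodesicb (T : finType) (adj : rel T) (u v z : T) : bool :=
  [exists p : (dist adj u v).-tuple T, geodesic adj u v p && (z \in u :: p)].

Lemma on_geodesicP (T : finType) (adj : rel T) (u v z : T) :
  reflect (on_geodesic adj u v z) (on_geodesicb adj u v z).
Proof.
apply: (iffP existsP) => [[p /andP[gp zp]]|[p [gp zp]]]; first by exists p.
have sp : size p == dist adj u v by case/andP: gp.
by exists (Tuple sp); rewrite /= gp zp.
Qed.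

Definition position_set (T : finType) (adj : rel T) (x : T) (S : {set T}) :
    bool :=
  [forall y in S, forall z in S :\ y, ~~ on_geodesicb adj x y z].

Lemma position_setP (T : finType) (adj : rel T) (x : T) (S : {set T}) :
  reflect (forall y z : T, y \in S -> z \in S :\ y -> ~ on_geodesic adj x y z)
          (position_set adj x S).
Proof.
apply: (iffP forall_inP) => [h y z yS zS|h y yS].
  by have /forall_inP/(_ z zS)/on_geodesicP := h y yS.
by apply/forall_inP => z zS; apply/on_geodesicP; apply: (h y z yS zS).
Qed.

Definition position_number (T : finType) (adj : rel T) (x : T) : nat :=
  \max_(S : {set T} | position_set adj x S) #|S|.

Definition eccentricity (T : finType) (adj : rel T) (x : T) : nat :=
  \max_(v : T) dist adj x v.

Definition diameter (T : finType) (adj : rel T) : nat :=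
  \max_(x : T) eccentricity adj x.

(* The two minima below use the neutral value #|T|, which bounds eccentricities
   and position numbers from above: see radiusP and vp_minusP. *)
Definition radius (T : finType) (adj : rel T) : nat :=
  \big[minn/#|T|]_(x : T) eccentricity adj x.

Definition vp (T : finType) (adj : rel T) : nat :=
  \max_(x : T) position_number adj x.

Definition vp_minus (T : finType) (adj : rel T) : nat :=
  \big[minn/#|T|]_(x : T) position_number adj x.

Lemma eccentricity_le (T : finType) (adj : rel T) (x : T) :
  eccentricity adj x <= #|T|.
Proof.
apply/bigmax_leqP => v _.
by rewrite -[leqRHS](size_iota 0) find_size.
Qed.

Lemma position_number_le (T : finType) (adj : rel T) (x : T) :
  position_number adj x <= #|T|.
Proof. by apply/bigmax_leqP => S _; apply: max_card. Qed.

Lemma bigmin_attained (T : finType) (F : T -> nat) (m : nat) :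
    0 < #|T| -> (forall x, F x <= m) ->
  (exists x, \big[minn/m]_(x : T) F x = F x) /\
  (forall x, \big[minn/m]_(x : T) F x <= F x).
Proof.
move=> /card_gt0P[x0 _] Fm.
have lb x : \big[minn/m]_(x : T) F x <= F x.
  have : x \in index_enum T by rewrite mem_index_enum.
  elim: (index_enum T) => // y s IHs; rewrite inE big_cons geq_min.
  by case/predU1P => [<-|/IHs ->]; rewrite ?leqnn ?orbT.
split=> //.
have : \big[minn/m]_(x : T) F x = m \/
       exists x, \big[minn/m]_(x : T) F x = F x.
  apply: (big_ind (fun k => k = m \/ exists x, k = F x)); first by left.
    by move=> k l hk hl; rewrite /minn; case: ifP.
  by move=> x _; right; exists x.
case=> // em; exists x0; apply/eqP.
by rewrite eqn_leq lb em Fm.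
Qed.

Lemma radiusP (T : finType) (adj : rel T) : 0 < #|T| ->
  (exists x, radius adj = eccentricity adj x) /\
  (forall x, radius adj <= eccentricity adj x).
Proof. by move=> T0; apply: bigmin_attained => // x; apply: eccentricity_le. Qed.

Lemma vp_minusP (T : finType) (adj : rel T) : 0 < #|T| ->
  (exists x, vp_minus adj = position_number adj x) /\
  (forall x, vp_minus adj <= position_number adj x).
Proof. by move=> T0; apply: bigmin_attained => // x; apply: position_number_le. Qed.

(* Main.v *)
Require Import Defs.
From mathcomp Require Import all_boot all_order all_algebra.
Import Order.TTheory GRing.Theory Num.Theory.
Local Open Scope ring_scope.

(** The vertices at a fixed distance [i] from [x] form an [x]-position set: an
    interior vertex of an [x,y]-geodesic is strictly closer to [x] than [y].
    The distance classes with [1 <= i <= e(x)] cover the [n - 1] vertices other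
    than [x], so [n - 1 <= e(x) * p_x(G)]. The bounds on [vp^-] and [vp] are
    instances at a vertex minimising [p_x], respectively the eccentricity. *)

Section DistanceClasses.

Variables (T : finType) (adj : rel T).
Local Open Scope nat_scope.

(** The vertices of a path are distinct, so its length is below [#|T|] and lies in the range that
    [find] searches. *)
Lemma dist_le_uv_path (u v : T) (p : seq T) :
  uv_path adj u v p -> dist adj u v <= size p.
Proof.
move=> puv; rewrite leqNgt; apply/negP => lt_p_dist.
have /and3P[_ _ /card_uniqP card_p] := puv.
have lt_p_T : size p < #|T|.
  by rewrite -[(size p).+1]/(size (u :: p)) -card_p max_card.
have := before_find 0 lt_p_dist; rewrite nth_iota // add0n.
by case/existsP; exists (in_tuple p).
Qed.

Lemma dist_eq0 (u v : T) : (dist adj u v == 0) = (u == v).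
Proof.
apply/eqP/eqP => [d0|->]; last first.
  by apply/eqP; rewrite -leqn0 (@dist_le_uv_path v v [::]) // /uv_path /= eqxx.
(* Since [#|T|] is positive, the value 0 is not the default of a failed search, so a path of length
   0 really exists. *)
have T0 : 0 < #|T| by apply/card_gt0P; exists u.
have has_path : has (has_uv_path adj u v) (iota 0 #|T|).
  by rewrite has_find -/(dist adj u v) d0 size_iota.
have := nth_find 0 has_path; rewrite -/(dist adj u v) d0 nth_iota //.
by case/existsP => p; rewrite tuple0 => /and3P[_ /eqP].
Qed.

(** Cutting the geodesic at [z] leaves a [u,z]-path, which is strictly shorter because [z != v]
    makes the removed tail nonempty. *)
Lemma on_geodesic_dist_lt (u v z : T) :
  on_geodesic adj u v z -> z != v -> dist adj u z < dist adj u v.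
Proof.
case=> p [/andP[/and3P[p_adj /eqP p_last p_uniq] /eqP <-] zp].
case/splitPl: zp p_adj p_last p_uniq => p1 p2 p1_last.
rewrite cat_path last_cat p1_last => /andP[p1_adj _] p2_last.
rewrite -cat_cons cat_uniq => /and3P[p1_uniq _ _] zv.
have : uv_path adj u z p1 by rewrite /uv_path p1_adj p1_last eqxx.
move=> /dist_le_uv_path/leq_ltn_trans -> //.
case: p2 p2_last => [/= zv'|w p2 _]; first by rewrite zv' eqxx in zv.
by rewrite size_cat /= addnS ltnS leq_addr.
Qed.

Lemma position_set_dist_class (x : T) (i : nat) :
  position_set adj x [set v | dist adj x v == i].
Proof.
apply/position_setP => y z; rewrite !inE => /eqP <- /andP[zy /eqP eq_dist].
by move=> /on_geodesic_dist_lt/(_ zy); rewrite eq_dist ltnn.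
Qed.

Lemma dist_le_eccentricity (x v : T) : dist adj x v <= eccentricity adj x.
Proof. exact: leq_bigmax. Qed.

Lemma card_le_eccentricity_position_number (x : T) :
  #|T| <= (eccentricity adj x * position_number adj x).+1.
Proof.
set e := eccentricity adj x.
have -> : #|T| = \sum_(i < e.+1) #|[set v | dist adj x v == i]|.
  rewrite -sum1_card.
  (* Distances from [x] are at most [e], so [inord] does not alter them. *)
  rewrite (partition_big (fun v => inord (dist adj x v) : 'I_e.+1) predT) //=.
  apply: eq_bigr => i _; rewrite -sum1dep_card; apply: eq_bigl => v.
  by rewrite -val_eqE /= inordK // ltnS dist_le_eccentricity.
(* The class at distance 0 lies in [[set x]] and accounts for the successor; each of the other [e]
   classes is a position set. *)
rewrite big_ord_recl -[leqRHS]add1n leq_add //.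
  rewrite -(cards1 x) subset_leq_card //.
  by apply/subsetP => v; rewrite !inE dist_eq0 eq_sym.
have <- : \sum_(i < e) position_number adj x = e * position_number adj x.
  by rewrite sum_nat_const card_ord.
apply: leq_sum => i _.
exact: (@leq_bigmax_cond _ _ (fun S : {set T} => #|S|) _
          (position_set_dist_class x _)).
Qed.

End DistanceClasses.

Lemma ler_pred_div (n e p : nat) :
  (2 <= n)%N -> (n <= (e * p).+1)%N -> (n%:R - 1) / e%:R <= p%:R :> rat.
Proof.
move=> n_ge2 n_le.
(* For [e = 0] the hypothesis would read [n <= 1]. *)
have e_gt0 : (0 < e)%N by case: e n_le => // /(leq_trans n_ge2).
by rewrite ler_pdivrMr ?ltr0n // lerBlDr -natrM natr1 ler_nat mulnC.
Qed.

Theorem lemma2p6 (T : finType) (adj : rel T)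
    (adj_sym : symmetric adj) (adj_irr : irreflexive adj)
    (adj_conn : connected_graph adj) (n : nat) (order_n : #|T| = n)
    (n_ge2 : (2 <= n)%N) :
  (forall x : T,
     (position_number adj x)%:R >= (n%:R - 1) / (eccentricity adj x)%:R :> rat)
  /\ (vp_minus adj)%:R >= (n%:R - 1) / (diameter adj)%:R :> rat
  /\ (vp adj)%:R >= (n%:R - 1) / (radius adj)%:R :> rat.
Proof.
have T_gt0 : (0 < #|T|)%N by rewrite order_n (leq_trans _ n_ge2).
have n_le x : (n <= (eccentricity adj x * position_number adj x).+1)%N.
  by rewrite -order_n card_le_eccentricity_position_number.
split=> [x|]; first exact: ler_pred_div.
(* At the minimising vertex, the other factor is enlarged: the eccentricity to the diameter,
   respectively the position number to [vp]. *)
split; apply: ler_pred_div => //.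
  have [[x ->] _] := vp_minusP adj T_gt0.
  by rewrite (leq_trans (n_le x)) // ltnS leq_mul2r leq_bigmax ?orbT.
have [[x ->] _] := radiusP adj T_gt0.
by rewrite (leq_trans (n_le x)) // ltnS leq_mul2l leq_bigmax ?orbT.
Qed.
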